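(* Every nilpotent real Lie algebra of dimension at most $7$ that admits a nice basis has a Ricci-flat metric.
   Context: A basis $\{e_1,\dots,e_n\}$ of a Lie algebra $\mathfrak{g}$, with dual basis $\{e^1,\dots,e^n\}$, is nice if each $[e_i,e_j]$ is a multiple of a single basis element $e_k$ depending on $i,j$, and each interior product $e_i\lrcorner de^j$ (where $d$ is the Chevalley--Eilenberg differential, $de^j(x,y)=-e^j([x,y])$) is a multiple of a single $e^h$ depending on $i,j$. A metric on $\mathfrak{g}$ is a nondegenerate symmetric bilinear form (of any signature), identified with the left-invariant pseudo-Riemannian metric it defines on a Lie group with Lie algebra $\mathfrak{g}$; Ricci-flat means that the Ricci tensor of its Levi-Civita connection vanishes. *)

(* Defs.v *)
From mathcomp Require Import all_boot all_order all_algebra.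

Set Implicit Arguments.
Unset Strict Implicit.
Unset Printing Implicit Defensive.

Import GRing.Theory.
Local Open Scope ring_scope.

Section LieAlgebra.
Variables (F : fieldType) (g : vectType F) (br : {bilinear g -> g -> g}).

Definition is_lie_bracket : Prop :=
  (forall x, br x x = 0) /\
  (forall x y z, br x (br y z) + br y (br z x) + br z (br x y) = 0).

Definition lie_prod (U V : {vspace g}) : {vspace g} :=
  <<[seq br x y | x <- vbasis U, y <- vbasis V]>>%VS.

Definition lower_central (k : nat) : {vspace g} :=
  iter k (lie_prod fullv) fullv.

Definition nilpotent_lie : Prop := exists k, lower_central k = 0%VS.

(* Chevalley--Eilenberg differential of a covector *)
Definition ce_diff (a : g -> F) (x y : g) : F := - a (br x y).

(* [coord b] is the dual basis of [b]; the interior product e_i _| de^j is the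
   covector [ce_diff (coord b j) b`_i]. *)
Definition nice_basis (n : nat) (b : n.-tuple g) : Prop :=
  [/\ basis_of fullv b,
      forall i j : 'I_n, exists (k : 'I_n) (c : F), br b`_i b`_j = c *: b`_k
    & forall i j : 'I_n, exists (h : 'I_n) (c : F),
        forall x, ce_diff (coord b j) b`_i x = c * coord b h x].

(* Levi-Civita connection of the left-invariant metric [B], restricted to
   left-invariant vector fields: on those, B(y, z) is a constant function, so
   that compatibility with the metric reads B(D_x y, z) + B(y, D_x z) = 0. *)
Definition levi_civita (B : {symmetric g}) (D : {bilinear g -> g -> g}) : Prop :=
  (forall x y, D x y - D y x = br x y) /\
  (forall x y z, B (D x y) z + B y (D x z) = 0).

Definition curvature (D : {bilinear g -> g -> g}) (x y z : g) : g :=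
  D x (D y z) - D y (D x z) - D (br x y) z.

Definition endo_trace (f : g -> g) : F :=
  \sum_(i < \dim {:g}) coord (vbasis {:g}) i (f (vbasis {:g})`_i).

(* Ric(y, z) is the trace of x |-> R(x, y) z. *)
Definition ricci (D : {bilinear g -> g -> g}) (y z : g) : F :=
  endo_trace (fun x => curvature D x y z).

(* For nondegenerate [B] there is exactly one [D] with [levi_civita B D]. *)
Definition ricci_flat (B : {symmetric g}) : Prop :=
  exists2 D, levi_civita B D & forall y z, ricci D y z = 0.

End LieAlgebra.

(* Main.v *)
(* Sort the nice basis so that every bracket [e_i, e_j] is a multiple of some
   e_k with k > i, j, and look for a metric <e_i, e_(s i)> = w_i with s an
   involution of the indices.  By unimodularity and nilpotency the Ricci tensor
   of such a metric is a combination of the products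
     c_{a i}^k c_{b (s i)}^{s k}   and   c_{i j}^{s a} c_{s i, s j}^{s b},
   so it vanishes term by term as soon as s carries no "arrow" (i, j, k) with
   c_{i j}^k != 0 to a conflicting arrow; the weights w are then irrelevant.
   The possible sets of arrows in dimension at most 7 form a finite decision
   problem, constrained by niceness (two arrows sharing two indices in the same
   roles coincide) and by the Jacobi identity (a nonzero term of it cannot
   stand alone).  A small decision tree finds a suitable s in every case but a
   few in dimensions 6 and 7, where the only surviving component of the Ricci
   tensor is Ric(e_x, e_x), with two kinds of terms that the weight of e_x can
   balance; the Jacobi identity makes the required square root rational. *)

Require Import Defs.
From HB Require Import structures.
From mathcomp Require Import all_boot all_order all_algebra.
From mathcomp Require Import ring reals.
Set Implicit Arguments.
Unset Strict Implicit.
Unset Printing Implicit Defensive.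
Import GRing.Theory Num.Theory.

(** * Arrow diagrams and decision trees *)

(* (i, j, k) stands for a nonzero k-th coordinate of [e_i, e_j]; the lists
   [known] and [possible] below only contain arrows with i < j. *)
Definition arrow := (nat * nat * nat)%type.

Definition sorted_arrow (i j k : nat) : arrow :=
  if i < j then (i, j, k) else (j, i, k).

Definition both_ways (L : seq arrow) : seq arrow :=
  L ++ [seq (t.1.2, t.1.1, t.2) | t <- L].

(** Niceness forbids distinct arrows with the same two sources, or with the same target and a common
    source. *)
Definition clash (t u : arrow) : bool :=
  let: (i, j, k) := t in let: (i', j', k') := u in
  [&& i == i', j == j' & k != k'] || (k == k') &&
    [|| (i == i') && (j != j'), (i == j') && (j != i'),
        (j == i') && (i != j') | (j == j') && (i != i')].

(* [Metric s e]: the involution s works, up to the exception e = Some (x, i, k)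
   treated in [special_flat].  [NoJacobi i j l m k]: the term
   [[e_i, e_j], e_l] = _ e_k, going through e_m, is alone in the Jacobi
   identity.  [Split t d1 d2]: case analysis on the presence of the arrow t. *)
Inductive tree :=
  | Metric of seq nat & option (nat * nat * nat)
  | NoJacobi of nat & nat & nat & nat & nat
  | Split of arrow & tree & tree.

Section Obstructions.
Variables (s : nat -> nat) (e : option (nat * nat * nat)).

(** The products excepted by [Some (x, i, k)] all belong to Ric(e_x, e_x): two of the kind in
    [ricci_ad], four of the kind in [ricci_jac]. *)
Definition ad_allowed (t u : arrow) : bool :=
  if e is Some (x, i, k) then
    [&& t.1.1 == x, u.1.1 == x
      & ((t.1.2, t.2) == (i, k)) || ((t.1.2, t.2) == (s i, s k))]
  else false.

Definition jac_allowed (t u : arrow) : bool :=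
  if e is Some (x, i, k) then
    [&& t.2 == s x, u.2 == s x
      & t.1 \in [:: (i, s k); (s k, i); (s i, k); (k, s i)]]
  else false.

(* [ad_meet] and [jac_meet] say that the structure constants of t and u are
   multiplied in [ricci_ad], resp. [ricci_jac], below. *)
Definition ad_meet (t u : arrow) : bool :=
  (u.1.2 == s t.1.2) && (u.2 == s t.2).

Definition jac_meet (t u : arrow) : bool :=
  (u.1.1 == s t.1.1) && (u.1.2 == s t.1.2).

Definition compatible (t u : arrow) : bool :=
  (ad_meet t u ==> ad_allowed t u) && (jac_meet t u ==> jac_allowed t u).

(** The last condition says [e_i, e_(s i)] = 0, which leaves two terms in the Jacobi identity for
    e_x, e_i, e_(s i); the four [known] arrows make both nonzero. *)
Definition special (n : nat) (known possible : pred arrow) : bool :=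
  if e is Some (x, i, k) then
    [&& s i != i, known (x, i, k), known (x, s i, s k), known (i, s k, s x),
        known (s i, k, s x) & all (fun m => ~~ possible (i, s i, m)) (iota 0 n)]
  else true.
End Obstructions.

Definition normal_mem (L : seq arrow) : pred arrow :=
  fun t => sorted_arrow t.1.1 t.1.2 t.2 \in L.

(** * Checking a decision tree, and soundness of the check *)

Section Search.
Variable n : nat.

Definition involution (s : seq nat) : bool :=
  all (fun i => (nth 0 s i < n) && (nth 0 s (nth 0 s i) == i)) (iota 0 n).

(** Along a branch, [known] arrows are present and, up to the order of the sources, every present
    arrow is in [possible]. A metric must therefore tolerate all possible arrows, and a Jacobi leaf
    is contradictory once the other two cyclic terms are impossible for every intermediate q. *)
Fixpoint covers (known possible : seq arrow) (d : tree) : bool :=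
  match d with
  | Metric s e =>
      [&& involution s,
          all (fun t => all (compatible (nth 0 s) e t) (both_ways possible))
            (both_ways possible)
        & special (nth 0 s) e n (normal_mem known) (normal_mem possible)]
  | NoJacobi i j l m k =>
      [&& normal_mem known (i, j, m), normal_mem known (m, l, k)
        & all (fun q =>
            ~~ (normal_mem possible (j, l, q) && normal_mem possible (q, i, k))
            && ~~ (normal_mem possible (l, i, q) && normal_mem possible (q, j, k)))
            (iota 0 n)]
  | Split t d1 d2 =>
      covers (t :: known) [seq u <- possible | ~~ clash t u] d1
      && covers known [seq u <- possible | u != t] d2
  end.

Variable P : pred arrow.
Hypothesis P_lt : forall i j k, P (i, j, k) -> [/\ i < k, j < k & k < n].
Hypothesis P_sym : forall i j k, P (i, j, k) = P (j, i, k).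
Hypothesis P_irr : forall i k, ~~ P (i, i, k).
Hypothesis P_target : forall i j k k', P (i, j, k) -> P (i, j, k') -> k = k'.
Hypothesis P_source : forall i j j' k, P (i, j, k) -> P (i, j', k) -> j = j'.
Hypothesis P_jacobi : forall i j l m k, P (i, j, m) -> P (m, l, k) ->
  exists q, P (j, l, q) && P (q, i, k) || P (l, i, q) && P (q, j, k).

Definition good_involution (s : nat -> nat) e : Prop :=
  [/\ forall i, i < n -> s i < n /\ s (s i) = i,
      forall t u, P t -> P u -> compatible s e t u
    & special s e n P P].

Lemma P_sorted i j k : P (sorted_arrow i j k) = P (i, j, k).
Proof. by rewrite /sorted_arrow; case: ifP => // _; apply: P_sym. Qed.

Lemma not_clash t u : P t -> P u -> ~~ clash t u.
Proof.
case: t u => [[i j] k] [[i' j'] k'] Pt Pu; apply/negP; case/orP=> [|/andP[/eqP]].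
  by case/and3P=> /eqP ? /eqP ? /eqP[]; subst; apply: P_target Pt Pu.
move=> ?; subst k'; have [Pt' Pu'] : P (j, i, k) /\ P (j', i', k).
  by rewrite P_sym Pt P_sym Pu.
case/or4P=> /andP[/eqP ? /eqP[]]; subst.
- exact: P_source Pt Pu.
- exact: P_source Pt Pu'.
- exact: P_source Pt' Pu.
- exact: P_source Pt' Pu'.
Qed.

Lemma normal_mem_P L t : {subset L <= P} -> normal_mem L t -> P t.
Proof. by case: t => [[i j] k] LP /LP; rewrite unfold_in P_sorted. Qed.

Lemma P_normal_mem L t :
  (forall i j k, i < j -> P (i, j, k) -> (i, j, k) \in L) ->
  P t -> normal_mem L t.
Proof.
case: t => [[i j] k] PL Pt; rewrite /normal_mem /sorted_arrow /=.
have [ij|ji|ij] := ltngtP i j; first exact: PL.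
  by apply: PL; rewrite // P_sym.
by move: Pt; rewrite ij (negPf (P_irr _ _)).
Qed.

Lemma P_both_ways L t :
  (forall i j k, i < j -> P (i, j, k) -> (i, j, k) \in L) ->
  P t -> t \in both_ways L.
Proof.
case: t => [[i j] k] PL /(P_normal_mem PL).
rewrite /normal_mem /sorted_arrow /both_ways mem_cat /=.
case: ifP => [_ -> //|_ jiL]; apply/orP; right.
by apply/mapP; exists (j, i, k).
Qed.

Lemma covers_sound d known possible :
  {subset known <= P} ->
  (forall i j k, i < j -> P (i, j, k) -> (i, j, k) \in possible) ->
  covers known possible d -> exists s e, good_involution s e.
Proof.
elim: d known possible => [s e|i j l m k|t d1 IH1 d2 IH2] K L KP PL /=.
- case/and3P=> /allP s_inv /allP compat spec; exists (nth 0 s), e; split.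
  + move=> i i_n; have := s_inv i; rewrite mem_iota => /(_ i_n).
    by case/andP=> ? /eqP.
  + move=> t u /(P_both_ways PL) tL /(P_both_ways PL).
    by move: (compat t tL) => /allP; apply.
  + case: e spec {compat} => [[[x i] k]|] //=.
    case/and5P=> -> K1 K2 K3 /andP[K4 /allP none].
    rewrite !(normal_mem_P KP) //=; apply/allP => m /none.
    by apply: contra; apply: P_normal_mem.
- case/and3P=> Kijm Kmlk /allP none.
  have [] := P_jacobi (normal_mem_P KP Kijm) (normal_mem_P KP Kmlk).
  (* The test ranges over q < n only, which suffices because targets of present arrows are below
     n. *)
  move=> q; have [q_n|n_q] := ltnP q n; last first.
    by case/orP=> /andP[/P_lt[_ _]]; rewrite ltnNge n_q.
  have := none q; rewrite mem_iota => /(_ q_n) /andP[n1 n2].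
  by case/orP=> /andP[P1 P2]; [move: n1|move: n2]; rewrite !(P_normal_mem PL).
- case/andP=> c1 c2; have [Pt|nPt] := boolP (P t).
    apply: IH1 c1 => [u|i j k ij Pijk].
      by rewrite inE => /predU1P[->|/KP].
    by rewrite mem_filter not_clash // PL.
  apply: IH2 c2 => // i j k ij Pijk; rewrite mem_filter PL // andbT.
  by apply: contraNneq nPt => <-.
Qed.

(** Only i < j < k < n can occur in a basis ordered so that brackets go up. *)
Definition all_arrows : seq arrow :=
  [seq (ij, k) | k <- iota 0 n, ij <- [seq (i, j) | j <- iota 0 k, i <- iota 0 j]].

Lemma covers_exists d :
  covers [::] all_arrows d -> exists s e, good_involution s e.
Proof.
apply: covers_sound => // i j k ij Pijk; have [_ jk k_n] := P_lt Pijk.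
apply/allpairsPdep; exists k, (i, j); split; rewrite ?mem_iota //.
by apply/allpairsPdep; exists j, i; rewrite !mem_iota /=.
Qed.
End Search.

(* These trees come from a computer search for small certificates. *)
Definition tree3 : tree :=
  Metric [:: 0; 2; 1] None.

Definition tree4 : tree :=
  Split (0, 2, 3) (Metric [:: 3; 2; 1; 0] None) (Metric [:: 2; 3; 0; 1] None).

Definition tree5 : tree :=
  Split (2, 3, 4) (Split (0, 1, 2) (NoJacobi 0 1 3 2 4) (Metric
  [:: 0; 3; 4; 1; 2] None)) (Split (0, 3, 4) (Metric [:: 4; 3; 2; 1; 0] None)
  (Metric [:: 3; 4; 2; 0; 1] None)).

Definition tree6 : tree :=
  Split (2, 3, 4) (Split (0, 1, 2) (NoJacobi 0 1 3 2 4) (Split (3, 4, 5)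
  (Split (0, 1, 4) (NoJacobi 0 1 3 4 5) (Metric [:: 0; 3; 5; 1; 4; 2] None))
  (Split (0, 4, 5) (NoJacobi 2 3 0 4 5) (Split (1, 4, 5) (NoJacobi 2 3 1 4 5)
  (Split (0, 3, 5) (Metric [:: 4; 3; 5; 1; 0; 2] None) (Metric
  [:: 3; 4; 5; 0; 1; 2] None)))))) (Split (3, 4, 5) (Split (1, 2, 3)
  (NoJacobi 1 2 4 3 5) (Split (0, 2, 3) (NoJacobi 2 0 4 3 5) (Split (0, 3, 4)
  (Metric [:: 5; 4; 2; 3; 1; 0] None) (Metric [:: 4; 5; 2; 3; 0; 1] None))))
  (Split (2, 4, 5) (Split (0, 3, 5) (Split (1, 3, 4) (NoJacobi 3 1 2 4 5)
  (Metric [:: 5; 4; 3; 2; 1; 0] None)) (Split (0, 3, 4) (NoJacobi 0 3 2 4 5)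
  (Metric [:: 4; 5; 3; 2; 0; 1] None))) (Split (2, 3, 5) (Split (0, 1, 2)
  (Split (1, 3, 4) (Split (0, 2, 3) (NoJacobi 0 2 1 3 4) (Split (0, 4, 5)
  (Split (0, 2, 4) (Split (1, 2, 3) (Metric [:: 3; 5; 4; 0; 2; 1]
  (Some (1, 3, 4))) (Metric [:: 5; 2; 1; 4; 3; 0] None)) (Metric
  [:: 0; 5; 4; 3; 2; 1] None)) (NoJacobi 0 1 3 2 5))) (Split (1, 4, 5) (Split
  (0, 3, 4) (Split (1, 2, 4) (Split (0, 2, 3) (Metric [:: 5; 3; 4; 1; 2; 0]
  (Some (0, 3, 4))) (Metric [:: 2; 5; 0; 4; 3; 1] None)) (Split (1, 2, 3)
  (NoJacobi 1 2 0 3 4) (Metric [:: 5; 1; 4; 3; 2; 0] None))) (NoJacobi 0 1 3 2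
  5)) (NoJacobi 0 1 3 2 5))) (Split (0, 3, 4) (Split (1, 4, 5) (NoJacobi 0 3 1
  4 5) (Metric [:: 5; 3; 4; 1; 2; 0] None)) (Split (0, 4, 5) (Split (1, 3, 4)
  (NoJacobi 3 1 0 4 5) (Metric [:: 3; 4; 5; 0; 1; 2] None)) (Metric
  [:: 3; 5; 4; 0; 2; 1] None)))) (Split (1, 4, 5) (Metric
  [:: 4; 5; 3; 2; 0; 1] None) (Metric [:: 5; 4; 3; 2; 1; 0] None))))).

Definition tree7 : tree :=
  Split (4, 5, 6) (Split (2, 3, 4) (NoJacobi 2 3 5 4 6) (Split (0, 3, 4)
  (NoJacobi 0 3 5 4 6) (Split (2, 3, 5) (NoJacobi 3 2 4 5 6) (Split (1, 3, 4)
  (NoJacobi 3 1 5 4 6) (Split (2, 3, 6) (Split (0, 1, 2) (NoJacobi 0 1 3 2 6)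
  (Split (3, 4, 5) (Metric [:: 3; 5; 6; 0; 4; 1; 2] None) (Split (0, 3, 5)
  (NoJacobi 3 0 4 5 6) (Split (1, 4, 5) (Metric [:: 3; 6; 5; 0; 4; 2; 1] None)
  (Metric [:: 3; 5; 6; 0; 4; 1; 2] None))))) (Split (0, 4, 5) (Metric
  [:: 6; 5; 3; 2; 4; 1; 0] None) (Split (3, 4, 5) (Metric
  [:: 5; 6; 3; 2; 4; 0; 1] None) (Metric [:: 5; 6; 3; 2; 4; 0; 1] None))))))))
  (Split (3, 4, 6) (Split (2, 4, 5) (Split (0, 1, 2) (NoJacobi 0 1 4 2 5)
  (Split (0, 3, 4) (NoJacobi 0 3 2 4 5) (Split (0, 3, 5) (Split (1, 3, 4)
  (NoJacobi 3 1 2 4 5) (Split (0, 5, 6) (Metric [:: 6; 4; 5; 3; 1; 2; 0] None)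
  (Metric [:: 5; 4; 6; 3; 1; 0; 2] None))) (Split (1, 5, 6) (Metric
  [:: 4; 6; 5; 3; 0; 2; 1] None) (Metric [:: 4; 5; 6; 3; 0; 1; 2] None)))))
  (Split (2, 3, 5) (Split (0, 1, 2) (Split (0, 4, 5) (Split (1, 2, 3)
  (NoJacobi 1 2 4 3 6) (Split (2, 5, 6) (NoJacobi 0 1 5 2 6) (Split (1, 5, 6)
  (NoJacobi 0 4 1 5 6) (Split (0, 2, 3) (NoJacobi 0 2 4 3 6) (Metric
  [:: 6; 4; 2; 5; 1; 3; 0] None))))) (Split (2, 5, 6) (NoJacobi 0 1 5 2 6)
  (Split (1, 4, 5) (Split (0, 2, 3) (NoJacobi 0 2 4 3 6) (Split (1, 2, 3)
  (NoJacobi 1 2 4 3 6) (Split (0, 5, 6) (NoJacobi 4 1 0 5 6) (Metric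
  [:: 4; 6; 2; 5; 0; 3; 1] None)))) (NoJacobi 0 1 3 2 5)))) (Split (0, 4, 5)
  (Split (1, 3, 4) (NoJacobi 3 1 0 4 5) (Split (2, 5, 6) (Metric
  [:: 5; 4; 6; 3; 1; 0; 2] None) (Metric [:: 6; 4; 5; 3; 1; 2; 0] None)))
  (Split (0, 3, 4) (Split (0, 5, 6) (NoJacobi 2 3 0 5 6) (Split (1, 4, 5)
  (NoJacobi 0 3 1 4 5) (Metric [:: 5; 4; 6; 3; 1; 0; 2] None))) (Split
  (2, 5, 6) (Metric [:: 4; 5; 6; 3; 0; 1; 2] None) (Metric
  [:: 4; 6; 5; 3; 0; 2; 1] None))))) (Split (2, 3, 4) (Split (0, 4, 5)
  (NoJacobi 2 3 0 4 5) (Split (0, 1, 2) (NoJacobi 0 1 3 2 4) (Split (0, 3, 5)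
  (Split (1, 4, 5) (NoJacobi 2 3 1 4 5) (Split (0, 5, 6) (Metric
  [:: 6; 4; 5; 3; 1; 2; 0] None) (Metric [:: 5; 4; 6; 3; 1; 0; 2] None)))
  (Split (2, 5, 6) (Metric [:: 4; 5; 6; 3; 0; 1; 2] None) (Metric
  [:: 4; 6; 5; 3; 0; 2; 1] None))))) (Split (0, 4, 5) (Split (1, 5, 6) (Metric
  [:: 5; 6; 4; 3; 2; 0; 1] None) (Metric [:: 6; 5; 4; 3; 2; 1; 0] None))
  (Split (0, 5, 6) (Metric [:: 6; 5; 4; 3; 2; 1; 0] None) (Metric
  [:: 5; 6; 4; 3; 2; 0; 1] None)))))) (Split (3, 4, 5) (Split (3, 5, 6) (Split
  (0, 3, 4) (Split (2, 4, 6) (Split (0, 1, 2) (NoJacobi 0 1 4 2 6) (Metric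
  [:: 6; 4; 5; 3; 1; 2; 0] None)) (Metric [:: 6; 5; 4; 3; 2; 1; 0] None))
  (Split (2, 3, 4) (Split (0, 1, 2) (NoJacobi 0 1 3 2 4) (Split (0, 4, 6)
  (Metric [:: 5; 4; 6; 3; 1; 0; 2] None) (Metric [:: 4; 5; 6; 3; 0; 1; 2]
  None))) (Split (2, 4, 6) (Split (0, 1, 2) (NoJacobi 1 0 4 2 6) (Metric
  [:: 4; 6; 5; 3; 0; 2; 1] None)) (Metric [:: 5; 6; 4; 3; 2; 0; 1] None))))
  (Split (2, 5, 6) (NoJacobi 3 4 2 5 6) (Split (2, 3, 6) (Split (0, 1, 2)
  (Split (0, 2, 3) (NoJacobi 0 2 4 3 5) (Split (1, 2, 3) (NoJacobi 1 2 4 3 5)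
  (Split (0, 5, 6) (NoJacobi 4 3 0 5 6) (Split (0, 4, 6) (Split (1, 5, 6)
  (NoJacobi 4 3 1 5 6) (Metric [:: 5; 4; 2; 6; 1; 0; 3] None)) (Metric
  [:: 4; 6; 2; 5; 0; 3; 1] None))))) (Split (0, 4, 6) (Split (1, 3, 4)
  (NoJacobi 3 1 0 4 6) (Metric [:: 6; 4; 5; 3; 1; 2; 0] None)) (Split
  (0, 3, 4) (Split (1, 4, 6) (NoJacobi 0 3 1 4 6) (Metric
  [:: 6; 4; 5; 3; 1; 2; 0] None)) (Metric [:: 4; 6; 5; 3; 0; 2; 1] None))))
  (Split (2, 3, 4) (Split (0, 5, 6) (NoJacobi 4 3 0 5 6) (Split (0, 1, 2)
  (NoJacobi 0 1 3 2 4) (Split (0, 4, 6) (NoJacobi 2 3 0 4 6) (Split (0, 3, 6)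
  (Split (1, 4, 6) (NoJacobi 2 3 1 4 6) (Metric [:: 5; 4; 6; 3; 1; 0; 2]
  None)) (Metric [:: 4; 6; 5; 3; 0; 2; 1] None))))) (Split (0, 5, 6)
  (NoJacobi 3 4 0 5 6) (Split (2, 4, 6) (Split (0, 1, 2) (NoJacobi 1 0 4 2 6)
  (Split (0, 3, 4) (NoJacobi 0 3 2 4 6) (Split (0, 3, 6) (Split (1, 3, 4)
  (NoJacobi 3 1 2 4 6) (Metric [:: 5; 4; 6; 3; 1; 0; 2] None)) (Metric
  [:: 4; 6; 5; 3; 0; 2; 1] None)))) (Metric [:: 5; 6; 4; 3; 2; 0; 1]
  None))))))) (Split (2, 5, 6) (Split (0, 1, 2) (NoJacobi 0 1 5 2 6) (Split
  (0, 4, 6) (Split (1, 4, 5) (NoJacobi 4 1 2 5 6) (Metric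
  [:: 5; 4; 6; 3; 1; 0; 2] None)) (Split (0, 4, 5) (NoJacobi 0 4 2 5 6)
  (Metric [:: 4; 5; 6; 3; 0; 1; 2] None)))) (Split (2, 4, 5) (Split (3, 5, 6)
  (NoJacobi 2 4 3 5 6) (Split (0, 5, 6) (NoJacobi 2 4 0 5 6) (Split (0, 1, 2)
  (NoJacobi 0 1 4 2 5) (Split (0, 4, 6) (Split (1, 5, 6) (NoJacobi 2 4 1 5 6)
  (Metric [:: 5; 4; 6; 3; 1; 0; 2] None)) (Metric [:: 4; 6; 5; 3; 0; 2; 1]
  None))))) (Split (0, 3, 4) (Split (0, 5, 6) (Split (2, 4, 6) (Split
  (0, 1, 2) (Split (1, 4, 5) (Split (0, 2, 3) (Split (1, 2, 4) (Metric
  [:: 4; 6; 5; 3; 0; 2; 1] (Some (1, 0, 2))) (Split (2, 3, 5) (Metric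
  [:: 4; 6; 5; 3; 0; 2; 1] (Some (1, 0, 2))) (NoJacobi 0 3 1 4 5))) (Split
  (0, 2, 5) (NoJacobi 0 3 1 4 5) (Metric [:: 0; 6; 5; 4; 3; 2; 1] None)))
  (NoJacobi 1 0 4 2 6)) (Split (1, 4, 5) (NoJacobi 4 1 0 5 6) (Metric
  [:: 6; 4; 5; 3; 1; 2; 0] None))) (Metric [:: 6; 5; 4; 3; 2; 1; 0] None))
  (Split (3, 5, 6) (Split (1, 3, 5) (Split (1, 4, 6) (NoJacobi 0 3 1 4 6)
  (Split (0, 4, 5) (NoJacobi 4 0 3 5 6) (Metric [:: 6; 4; 5; 3; 1; 2; 0]
  None))) (Split (2, 4, 6) (Split (0, 1, 2) (NoJacobi 1 0 4 2 6) (Split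
  (0, 4, 5) (NoJacobi 0 3 2 4 6) (Metric [:: 4; 5; 6; 3; 0; 1; 2] None)))
  (Metric [:: 6; 5; 4; 3; 2; 1; 0] None))) (Split (2, 4, 6) (NoJacobi 0 3 2 4
  6) (Metric [:: 5; 6; 4; 3; 2; 0; 1] None)))) (Split (3, 5, 6) (Split
  (2, 4, 6) (Split (0, 1, 2) (NoJacobi 1 0 4 2 6) (Split (0, 3, 5) (Split
  (1, 3, 4) (Metric [:: 4; 6; 5; 3; 0; 2; 1] None) (Metric
  [:: 4; 5; 6; 3; 0; 1; 2] None)) (Split (1, 4, 5) (NoJacobi 4 1 3 5 6)
  (Metric [:: 5; 4; 6; 3; 1; 0; 2] None)))) (Split (0, 3, 5) (Split (1, 3, 4)
  (Split (1, 4, 5) (NoJacobi 4 1 3 5 6) (Split (0, 4, 6) (NoJacobi 3 1 0 4 6)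
  (Metric [:: 4; 6; 5; 3; 0; 2; 1] None))) (Metric [:: 6; 5; 4; 3; 2; 1; 0]
  None)) (Metric [:: 5; 6; 4; 3; 2; 0; 1] None))) (Split (2, 4, 6) (Split
  (0, 1, 2) (Split (0, 4, 5) (Split (1, 5, 6) (Split (2, 3, 4) (NoJacobi 2 3 0
  4 5) (Split (1, 3, 4) (Split (0, 2, 4) (Split (2, 3, 5) (Split (1, 2, 3)
  (Metric [:: 6; 4; 5; 3; 1; 2; 0] (Some (0, 1, 2))) (Metric
  [:: 6; 1; 5; 4; 3; 2; 0] None)) (NoJacobi 3 1 2 4 6)) (Split (2, 3, 5)
  (Split (1, 2, 3) (Metric [:: 6; 4; 5; 3; 1; 2; 0] (Some (0, 1, 2))) (Metric
  [:: 6; 1; 5; 4; 3; 2; 0] None)) (NoJacobi 3 1 2 4 6))) (Split (2, 3, 5)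
  (NoJacobi 3 2 1 5 6) (Metric [:: 5; 6; 3; 2; 4; 0; 1] None)))) (NoJacobi 1 0
  4 2 6)) (Split (0, 5, 6) (Split (1, 4, 5) (Split (2, 3, 4) (NoJacobi 2 3 1 4
  5) (Split (1, 3, 4) (NoJacobi 3 1 2 4 6) (Split (2, 3, 5) (NoJacobi 3 2 0 5
  6) (Metric [:: 6; 5; 3; 2; 4; 1; 0] None)))) (NoJacobi 1 0 4 2 6))
  (NoJacobi 0 1 4 2 6))) (Split (0, 4, 5) (Split (1, 5, 6) (NoJacobi 0 4 1 5
  6) (Metric [:: 6; 4; 5; 3; 1; 2; 0] None)) (Split (0, 5, 6) (Split (1, 4, 5)
  (NoJacobi 4 1 0 5 6) (Metric [:: 4; 5; 6; 3; 0; 1; 2] None)) (Metric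
  [:: 4; 6; 5; 3; 0; 2; 1] None)))) (Split (0, 5, 6) (Metric
  [:: 6; 5; 4; 3; 2; 1; 0] None) (Metric [:: 5; 6; 4; 3; 2; 0; 1]
  None))))))))).


(** The trees are checked by computation. Below dimension 3 there is no arrow, so any involution
    serves. *)
Lemma tree_covers n : n <= 7 -> exists d, covers n [::] (all_arrows n) d.
Proof.
case: n => [|[|[|[|[|[|[|[|n]]]]]]]] // _.
- by exists (Metric [::] None).
- by exists (Metric [::] None).
- by exists (Metric [:: 0; 1] None).
- by exists tree3.
- by exists tree4.
- by exists tree5.
- by exists tree6; vm_compute.
- by exists tree7; vm_compute.
Qed.

Local Open Scope ring_scope.

(** * Ricci tensor of a metric pairing basis vectors *)

Section BilinearExtension.
Variables (F : fieldType) (g : vectType F) (n : nat) (e : n.-tuple g).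

Definition bilinear_ext (T : 'I_n -> 'I_n -> g) (x y : g) : g :=
  \sum_i \sum_j (coord e i x * coord e j y) *: T i j.

Fact bilinear_ext_bilinear T :
  bilinear_for (GRing.Scale.Law.clone _ _ *:%R _)
    (GRing.Scale.Law.clone _ _ *:%R _) (bilinear_ext T).
Proof.
split=> z a x y; rewrite /bilinear_ext /= scaler_sumr -big_split /=;
  apply: eq_bigr => i _; rewrite scaler_sumr -big_split /=;
  apply: eq_bigr => j _; rewrite linearP /= scalerA -scalerDl.
  by rewrite mulrDl mulrA.
by rewrite mulrDr mulrCA.
Qed.

HB.instance Definition _ T :=
  bilinear_isBilinear.Build F g g g _ _ (bilinear_ext T)
    (bilinear_ext_bilinear T).

Variables (s : 'I_n -> 'I_n) (w : 'I_n -> F).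

(** It pairs e_i with e_(s i) to the value w_i and makes all other products of basis vectors
    zero. *)
Definition sdiag_form (x y : g) : F :=
  \sum_i w i * (coord e i x * coord e (s i) y).

Fact sdiag_form_bilinear :
  bilinear_for (GRing.Scale.Law.clone _ _ *%R _)
    (GRing.Scale.Law.clone _ _ (idfun \; *%R) _) sdiag_form.
Proof.
split=> z a x y; rewrite /sdiag_form /= mulr_sumr -big_split /=;
  by apply: eq_bigr => i _; rewrite linearP /=; ring.
Qed.

HB.instance Definition _ :=
  bilinear_isBilinear.Build F g g F _ _ sdiag_form sdiag_form_bilinear.
Hypotheses (sK : involutive s) (ws : forall i, w (s i) = w i).

Fact sdiag_form_sym x y : sdiag_form x y = (-1) ^+ false * idfun (sdiag_form y x).
Proof.
rewrite mul1r /sdiag_form /= (reindex_inj (inv_inj sK)) /=.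
by apply: eq_bigr => i _; rewrite ws sK; congr (_ * _); rewrite mulrC.
Qed.

Definition sdiag_metric : {symmetric g} :=
  HB.pack sdiag_form
    (isHermitianSesquilinear.Build F g false idfun sdiag_form sdiag_form_sym).
End BilinearExtension.

(** * Coordinates, traces and curvature in an arbitrary basis *)

Section Coordinates.
Variables (F : fieldType) (g : vectType F) (n : nat) (e : n.-tuple g).
Hypothesis e_basis : basis_of fullv e.

Lemma coord_basis_sum (k : 'I_n -> F) j :
  coord e j (\sum_i k i *: e`_i) = k j.
Proof. exact: coord_sum_free (basis_free e_basis). Qed.

Lemma bilinear_extE (f : {bilinear g -> g -> g}) x y :
  f x y = bilinear_ext e (fun i j => f e`_i e`_j) x y.
Proof.
rewrite {1}(coord_basis e_basis (memvf x)) linear_sumlz; apply: eq_bigr => i _.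
rewrite {1}(coord_basis e_basis (memvf y)) linear_sumr; apply: eq_bigr => j _.
by rewrite linearZl_LR linearZr_LR scalerA.
Qed.

Lemma scalar_basis_eq0 (f : g -> F) :
  scalar f -> (forall i : 'I_n, f e`_i = 0) -> forall x, f x = 0.
Proof.
move=> f_lin f0 x; pose h : {linear g -> F^o} :=
  HB.pack f (GRing.isLinear.Build F g F^o *:%R f f_lin).
rewrite (coord_basis e_basis (memvf x)) -[LHS]/(h _) linear_sum big1 // => i _.
by rewrite linearZ /= f0 scaler0.
Qed.

(** Pairing with e_(s i) isolates w_i times the i-th coordinate, so a vector of the radical has zero
    coordinates. *)
Lemma sdiag_metric_nondegenerate s w sK ws :
  (forall i, w i != 0) -> nondegenerate (@sdiag_metric F g n e s w sK ws).
Proof.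
move=> w_neq0; rewrite /nondegenerate -subv0; apply/subvP => x.
move/mem_orthovP => x_rad; rewrite memv0 (coord_basis e_basis (memvf x)).
rewrite big1 // => i _; apply/eqP; rewrite scaler_eq0; apply/orP; left.
have := x_rad e`_(s i) (memvf _); rewrite /= /sdiag_form (bigD1 i) //=.
rewrite (coord_free (s i)) ?(basis_free e_basis) // eqxx mulr1 big1 ?addr0.
  by move=> /eqP; rewrite mulf_eq0 (negPf (w_neq0 i)).
move=> j j_neq; rewrite (coord_free (s i)) ?(basis_free e_basis) //.
by rewrite eq_sym (inj_eq (inv_inj sK)) (negPf j_neq) !mulr0.
Qed.
End Coordinates.

(** [endo_trace] is written in [vbasis]; expanding each basis in the other gives the same double
    sum. *)
Lemma endo_trace_basis (F : fieldType) (g : vectType F)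
    (e : (\dim {:g}).-tuple g) (f : {linear g -> g}) :
  basis_of fullv e -> endo_trace f = \sum_i coord e i (f e`_i).
Proof.
move=> e_basis; rewrite /endo_trace; set v := vbasis _.
transitivity (\sum_(i < \dim {:g}) \sum_(j < \dim {:g})
      coord e j v`_i * coord v i (f e`_j)).
  apply: eq_bigr => i _; rewrite {1}(coord_basis e_basis (memvf v`_i)).
  rewrite !linear_sum; apply: eq_bigr => j _.
  by rewrite !linearZ.
rewrite exchange_big; apply: eq_bigr => j _ /=.
rewrite {2}(coord_vbasis (memvf (f e`_j))) linear_sum.
by apply: eq_bigr => i _; rewrite linearZ mulrC.
Qed.

Section CurvatureLinearity.
Variables (F : fieldType) (g : vectType F) (br D : {bilinear g -> g -> g}).

(** Linearity in x lets the Ricci trace be computed in the basis e; linearity in y and z reduces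
    Ricci-flatness to basis vectors. *)
Lemma curvature_linear y z : linear (fun x => curvature br D x y z).
Proof.
move=> k u v; rewrite /curvature /= !(linearDl, linearZl_LR) /=.
rewrite !(linearDr, linearZr_LR) /= !scalerBr.
by rewrite !opprD [X in X + _ = _]addrACA; apply: addrACA.
Qed.

Lemma ricci_scalarl z : scalar (fun y => ricci br D y z).
Proof.
move=> k u v; rewrite /ricci /endo_trace mulr_sumr -big_split /=.
apply: eq_bigr => i _; rewrite -linearP; congr (coord _ _ _).
rewrite /curvature !(linearDl, linearZl_LR, linearDr, linearZr_LR) /=.
rewrite !scalerBr.
by rewrite !opprD [X in X + _ = _]addrACA; apply: addrACA.
Qed.

Lemma ricci_scalarr y : scalar (ricci br D y).
Proof.
move=> k u v; rewrite /ricci /endo_trace mulr_sumr -big_split /=.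
apply: eq_bigr => i _; rewrite -linearP; congr (coord _ _ _).
rewrite /curvature !(linearDr, linearZr_LR) /=.
rewrite !scalerBr !opprD [X in X + _ = _]addrACA; apply: addrACA.
Qed.

Lemma ricci_basis n (e : n.-tuple g) : basis_of fullv e ->
  (forall i j : 'I_n, ricci br D e`_i e`_j = 0) -> forall y z, ricci br D y z = 0.
Proof.
move=> e_basis ric0 y z; apply: (scalar_basis_eq0 e_basis (ricci_scalarr y)).
by move=> j; apply: (scalar_basis_eq0 e_basis (ricci_scalarl e`_j)).
Qed.
End CurvatureLinearity.

(** * Levi-Civita connection and Ricci tensor in structure constants *)

Section SDiagonalRicci.
Variables (F : numFieldType) (g : vectType F) (br : {bilinear g -> g -> g}).
Local Notation n := (\dim {:g}).
Variable e : n.-tuple g.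
Hypothesis e_basis : basis_of fullv e.

Definition struct_const (i j k : 'I_n) : F := coord e k (br e`_i e`_j).
Local Notation c := struct_const.

Hypothesis c_anti : forall i j k, c j i k = - c i j k.
Hypothesis c_up : forall i j k, c i j k != 0 -> (i < k)%N.

Variables (s : 'I_n -> 'I_n) (w : 'I_n -> F).
Hypotheses (sK : involutive s) (ws : forall i, w (s i) = w i).
Hypothesis w_neq0 : forall i, w i != 0.

(** The Koszul formula 2 B(D_x y, z) = B([x, y], z) - B([y, z], x) + B([z, x], y) at x = e_i, y =
    e_j, z = e_(s k), divided by 2 w_k. *)
Definition christoffel (i j k : 'I_n) : F :=
  (c i j k - w i / w k * c j (s k) (s i) + w j / w k * c (s k) i (s j)) / 2.
Local Notation Gam := christoffel.

Definition connection : {bilinear g -> g -> g} :=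
  bilinear_ext e (fun i j => \sum_k Gam i j k *: e`_k).
Local Notation D := connection.

Lemma coord_connection x y k :
  coord e k (D x y) = \sum_i \sum_j coord e i x * coord e j y * Gam i j k.
Proof.
rewrite /= /bilinear_ext linear_sum; apply: eq_bigr => i _.
rewrite linear_sum; apply: eq_bigr => j _.
by rewrite linearZ /= (coord_basis_sum e_basis).
Qed.

Lemma connection_levi_civita : levi_civita br (sdiag_metric e sK ws) D.
Proof.
(* The sum is reindexed by [s] so that z is expanded along e_k. *)
have formE x y z : sdiag_form e s w (D x y) z = \sum_i \sum_j \sum_k
    coord e i x * coord e j y * coord e k z * (w k * Gam i j (s k)).
  rewrite /sdiag_form (reindex_inj (inv_inj sK)) /=.
  under [RHS]eq_bigr do rewrite exchange_big.
  rewrite [RHS]exchange_big; apply: eq_bigr => k _ /=.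
  rewrite ws sK coord_connection mulr_suml mulr_sumr; apply: eq_bigr => i _.
  by rewrite mulr_suml mulr_sumr; apply: eq_bigr => j _; ring.
split=> [x y|x y z].
  have -> : D y x = \sum_i \sum_j (coord e i x * coord e j y) *:
      \sum_k Gam j i k *: e`_k.
    rewrite exchange_big; apply: eq_bigr => j _; apply: eq_bigr => i _ /=.
    by rewrite [coord e i x * _]mulrC.
  rewrite [RHS](bilinear_extE e_basis) /=.
  rewrite -sumrB; apply: eq_bigr => i _; rewrite -sumrB; apply: eq_bigr => j _.
  rewrite -scalerBr; congr (_ *: _).
  rewrite [RHS](coord_basis e_basis (memvf _)) -sumrB; apply: eq_bigr => k _.
  rewrite -scalerBl; congr (_ *: _); rewrite -/(c i j k) /Gam.
  (* By antisymmetry the last two Koszul terms have a sum symmetric in i and j, so only the bracket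
     survives. *)
  rewrite (c_anti i j) (c_anti j (s k)) (c_anti i (s k)).
  by field.
(* With D x z on the left, [formE] applies to both summands, which then cancel for each triple of
   indices. *)
have -> : sdiag_metric e sK ws y (D x z) = sdiag_form e s w (D x z) y.
  by rewrite (sdiag_form_sym e sK ws) mul1r.
rewrite /= !formE -big_split big1 //= => i _.
rewrite [X in _ + X]exchange_big -big_split big1 //= => j _.
rewrite -big_split big1 //= => k _.
rewrite (mulrAC (coord e i x)) -mulrDr /Gam !sK !ws.
rewrite (c_anti i j) (c_anti j k) (c_anti i k).
by field; rewrite !w_neq0.
Qed.

(** The trace of ad e_a composed with the metric adjoint of ad e_b. *)
Definition ricci_ad (a b : 'I_n) : F :=
  \sum_i \sum_k w k / w i * (c a i k * c b (s i) (s k)).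

(** The sum of B([e_i, e_j], e_a) B([f_i, f_j], e_b), where f_i = e_(s i) / w_i is the metric dual
    basis. *)
Definition ricci_jac (a b : 'I_n) : F :=
  \sum_i \sum_j w a * w b / (w i * w j) *
    (c i j (s a) * c (s i) (s j) (s b)).

Lemma connection_basis (i j : 'I_n) : D e`_i e`_j = \sum_k Gam i j k *: e`_k.
Proof.
rewrite (coord_basis e_basis (memvf (D _ _))); apply: eq_bigr => k _.
congr (_ *: _); rewrite coord_connection (bigD1 i) //= (bigD1 j) //=.
rewrite !(coord_free _ _ (basis_free e_basis)) !eqxx !mul1r.
rewrite !big1 ?addr0 // => [i' i'_neq|j' j'_neq].
  rewrite big1 // => j' _; rewrite (coord_free _ _ (basis_free e_basis)).
  by rewrite eq_sym (negPf i'_neq) !mul0r.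
rewrite (coord_free _ _ (basis_free e_basis)) eq_sym (negPf j'_neq).
by rewrite mulr0 mul0r.
Qed.

(* Writing N_y for x |-> D_x y, one has Ric(y, z) = tr(N_(D_y z)) - tr(N_y N_z)
   after cancelling tr(D_y N_z) against tr(N_z D_y); the first trace is zero
   since D_v is skew and ad v is nilpotent. *)
Lemma ricci_christoffel (a b : 'I_n) :
  ricci br D e`_a e`_b = - \sum_i \sum_m Gam i a m * Gam m b i.
Proof.
pose f : {linear g -> g} := HB.pack (fun x => curvature br D x e`_a e`_b)
  (GRing.isLinear.Build F g g *:%R _ (curvature_linear br D e`_a e`_b)).
rewrite /ricci -[LHS]/(endo_trace f) (endo_trace_basis _ e_basis) /=.
transitivity (\sum_i \sum_m (Gam a b m * Gam i m i
    - Gam i b m * Gam a m i - c i a m * Gam m b i)).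
  apply: eq_bigr => i _; rewrite /curvature !connection_basis.
  rewrite (coord_basis e_basis (memvf (br _ _))).
  rewrite !linear_sumr linear_sumlz !linearB /= !linear_sum -!sumrB /=.
  apply: eq_bigr => m _.
  rewrite !linearZr_LR linearZl_LR /= !linearZ /= !connection_basis.
  by rewrite !(coord_basis_sum e_basis).
have c_diag k l : c k l k = 0.
  by apply/eqP; apply: contraT => /c_up; rewrite ltnn.
have trace0 : \sum_i \sum_m Gam a b m * Gam i m i = 0.
  rewrite exchange_big big1 //= => m _; rewrite -mulr_sumr.
  apply/eqP; rewrite mulf_eq0; apply/orP; right.
  rewrite -mulr_suml mulf_eq0; apply/orP; left.
  under eq_bigr do rewrite c_diag (c_anti (s _) m) c_diag oppr0 mulr0 subr0 add0r.
  (* Only the last Koszul term is left; i -> s i exchanges its antisymmetric arguments, so X = -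
     X. *)
  set X := \sum_i _.
  have : X = - X.
    rewrite {1}/X (reindex_inj (inv_inj sK)) -sumrN /=.
    by apply: eq_bigr => i _; rewrite sK ws c_anti mulrN.
  by move/eqP; rewrite eq_sym eqNr.
have swap : \sum_i \sum_m Gam m b i * Gam a i m =
    \sum_i \sum_m Gam i b m * Gam a m i by rewrite exchange_big.
transitivity (\sum_i \sum_m Gam a b m * Gam i m i -
  \sum_i \sum_m Gam i b m * Gam a m i -
  \sum_i \sum_m c i a m * Gam m b i).
  rewrite -!sumrB; apply: eq_bigr => i _; rewrite -!sumrB.
  by apply: eq_bigr.
rewrite trace0 sub0r -swap -opprD -big_split /=; congr (- _).
apply: eq_bigr => i _; rewrite -big_split; apply: eq_bigr => m _ /=.
(* What remains is the absence of torsion: [Gam a i m + c i a m = Gam i a m]. *)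
rewrite [Gam m b i * _]mulrC -mulrDl; congr (_ * _); rewrite /Gam.
rewrite (c_anti i a) (c_anti a (s m)) (c_anti i (s m)).
by field.
Qed.

(** The products of Christoffel symbols expand into nine kinds of terms: three form the right-hand
    side, four cancel in pairs after reindexing, and two are Killing form terms, zero because
    brackets raise the index. *)
Lemma ricci_sdiag (a b : 'I_n) :
  4 * ricci br D e`_a e`_b = ricci_jac a b - ricci_ad a b - ricci_ad b a.
Proof.
have c_acyclic i j k l : c i j k * c k l i = 0.
  apply/eqP; rewrite mulf_eq0; apply/norP => [[/c_up ik /c_up]].
  by rewrite ltnNge ltnW.
have flip H : \sum_i \sum_m H i m = \sum_i \sum_m H (s m) (s i) :> F.
  rewrite exchange_big (reindex_inj (inv_inj sK)); apply: eq_bigr => i _.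
  by rewrite (reindex_inj (inv_inj sK)).
(* [P] and [Q] multiply a first by a third Koszul term; (i, m) -> (s m, s i) turns them into the
   products of a second and a third one, up to sign. *)
pose P i m := w b / w i * (c i a m * c (s i) m (s b)).
pose Q i m := w a / w m * (c (s m) i (s a) * c m b i).
pose J i m := w a * w b / (w m * w i) * (c (s m) i (s a) * c (s i) m (s b)).
have jacE : ricci_jac a b = - \sum_i \sum_m J i m.
  rewrite /ricci_jac (reindex_inj (inv_inj sK)) exchange_big -sumrN.
  apply: eq_bigr => i _; rewrite -sumrN; apply: eq_bigr => m _ /=.
  by rewrite /J sK ws (c_anti (s i) m) !mulrN.
have adE : ricci_ad b a =
    \sum_i \sum_m w i / w m * (c b m i * c a (s m) (s i)).
  by rewrite /ricci_ad exchange_big.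
rewrite ricci_christoffel mulrN mulr_sumr jacE adE.
transitivity (- (\sum_i \sum_m w m / w i * (c a i m * c b (s i) (s m)) +
    \sum_i \sum_m w i / w m * (c b m i * c a (s m) (s i)) +
    \sum_i \sum_m J i m + (\sum_i \sum_m P i m - \sum_i \sum_m P (s m) (s i)) +
    (\sum_i \sum_m Q i m - \sum_i \sum_m Q (s m) (s i)))); last first.
  by rewrite -!flip !subrr /ricci_ad; ring.
congr (- _); rewrite -!sumrB -!big_split; apply: eq_bigr => i _ /=.
rewrite mulr_sumr -!sumrB -!big_split; apply: eq_bigr => m _ /=.
rewrite /P /Q /J /Gam !sK !ws.
have XX : c i a m * c m b i = 0 by apply: c_acyclic.
have YY : c a (s m) (s i) * c b (s i) (s m) = 0.
  by rewrite (c_anti _ a) (c_anti _ b) mulrNN c_acyclic.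
rewrite (c_anti i a) (c_anti m b) (c_anti (s i) m) (c_anti a (s m)).
rewrite (c_anti (s m) i) (c_anti b (s i)).
(* The two sides differ exactly by the Killing terms [XX] and [YY]. *)
apply/eqP; rewrite -subr_eq0 -(addr0 0) -{1}XX -YY; apply/eqP.
by field; rewrite !w_neq0.
Qed.

Lemma sdiag_ricci_flat :
  (forall a b, ricci_jac a b = ricci_ad a b + ricci_ad b a) ->
  exists B : {symmetric g}, nondegenerate B /\ ricci_flat br B.
Proof.
move=> ric0; exists (sdiag_metric e sK ws); split.
  exact: (sdiag_metric_nondegenerate e_basis).
exists D; first exact: connection_levi_civita.
apply: (ricci_basis e_basis) => i j; apply/eqP.
have /eqP := ricci_sdiag i j.
by rewrite ric0 -addrA -opprD subrr mulf_eq0 pnatr_eq0.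
Qed.
End SDiagonalRicci.

Lemma sum_support (V : nmodType) (I : finType) (L : seq I) (f : I -> V) :
  uniq L -> (forall i, i \notin L -> f i = 0) -> \sum_i f i = \sum_(i <- L) f i.
Proof.
move=> L_uniq f0; rewrite [RHS]big_uniq // (bigID [in L]) /=.
by rewrite [X in _ + X]big1 ?addr0.
Qed.

(** * From diagrams to Ricci-flat metrics *)

Section GoodInvolutionFlat.
Variables (F : numFieldType) (g : vectType F) (br : {bilinear g -> g -> g}).
Local Notation n := (\dim {:g}).
Variable e : n.-tuple g.
Hypothesis e_basis : basis_of fullv e.
Local Notation c := (struct_const br e).

Hypothesis c_anti : forall i j k, c j i k = - c i j k.
Hypothesis c_up : forall i j k, c i j k != 0 -> (i < k)%N.
Hypothesis c_target : forall i j k k', c i j k != 0 -> c i j k' != 0 -> k = k'.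
Hypothesis c_source : forall i j j' k, c i j k != 0 -> c i j' k != 0 -> j = j'.
Hypothesis c_jacobi : forall i j l k,
  \sum_q (c i j q * c q l k + c j l q * c q i k + c l i q * c q j k) = 0.

(** The support of the structure constants, on triples of natural numbers because the trees compute
    with these; false out of range. *)
Definition nonzero_arrow (t : arrow) : bool :=
  [exists i, exists j, exists k,
     (t == (val i, val j, val k)) && (c i j k != 0)].
Local Notation P := nonzero_arrow.

Lemma nonzero_arrowP t :
  reflect (exists i j k : 'I_n, t = (val i, val j, val k) /\ c i j k != 0) (P t).
Proof.
apply: (iffP existsP) => [[i /existsP[j /existsP[k /andP[/eqP -> c0]]]]|].
  by exists i, j, k.
move=> [i [j [k [-> c0]]]]; exists i; apply/existsP; exists j; apply/existsP.
by exists k; rewrite eqxx.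
Qed.

Lemma nonzero_arrowE (i j k : 'I_n) : P (val i, val j, val k) = (c i j k != 0).
Proof.
apply/nonzero_arrowP/idP => [[i' [j' [k' [[]]]]]|]; last by exists i, j, k.
by move=> /val_inj -> /val_inj -> /val_inj ->.
Qed.

Lemma struct_const_irr i k : c i i k = 0.
Proof.
by apply/eqP; move: (c_anti i i k) => /eqP; rewrite eq_sym eqNr.
Qed.

Lemma nonzero_arrow_sym i j k : P (i, j, k) = P (j, i, k).
Proof.
by apply/nonzero_arrowP/nonzero_arrowP => -[i' [j' [k' [[-> -> ->] c0]]]];
  exists j', i', k'; rewrite c_anti oppr_eq0.
Qed.

Lemma nonzero_arrow_lt i j k : P (i, j, k) -> [/\ i < k, j < k & k < n]%N.
Proof.
move=> /nonzero_arrowP[i' [j' [k' [[-> -> ->] c0]]]]; split=> //.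
  exact: c_up c0.
by apply: (@c_up j' i'); rewrite c_anti oppr_eq0.
Qed.

Lemma nonzero_arrow_irr i k : ~~ P (i, i, k).
Proof.
apply/nonzero_arrowP => -[i' [j' [k' [[-> /val_inj-> _]]]]].
by rewrite struct_const_irr eqxx.
Qed.

Lemma nonzero_arrow_target i j k k' : P (i, j, k) -> P (i, j, k') -> k = k'.
Proof.
move=> /nonzero_arrowP[i1 [j1 [k1 [[-> -> ->] c1]]]].
move=> /nonzero_arrowP[i2 [j2 [k2 [[/val_inj ei /val_inj ej ->] c2]]]]; subst.
by rewrite (c_target c1 c2).
Qed.

Lemma nonzero_arrow_source i j j' k : P (i, j, k) -> P (i, j', k) -> j = j'.
Proof.
move=> /nonzero_arrowP[i1 [j1 [k1 [[-> -> ->] c1]]]].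
move=> /nonzero_arrowP[i2 [j2 [k2 [[/val_inj ei -> /val_inj ek] c2]]]]; subst.
by rewrite (c_source c1 c2).
Qed.

Lemma nonzero_arrow_jacobi i j l m k : P (i, j, m) -> P (m, l, k) ->
  exists q, P (j, l, q) && P (q, i, k) || P (l, i, q) && P (q, j, k).
Proof.
move=> /nonzero_arrowP[i1 [j1 [m1 [[-> -> ->] c1]]]].
move=> /nonzero_arrowP[m2 [l1 [k1 [[/val_inj em -> ->] c2]]]]; subst m2.
have [/existsP[q Pq]|/existsPn none] := boolP [exists q : 'I_n,
  (c j1 l1 q != 0) && (c q i1 k1 != 0) || (c l1 i1 q != 0) && (c q j1 k1 != 0)].
  by exists (val q); rewrite !nonzero_arrowE.
have /eqP := c_jacobi i1 j1 l1 k1.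
(* By niceness only q = m1 contributes to the first cyclic sum; if the other two were zero, this
   nonzero product would be the whole identity. *)
rewrite (bigD1 m1) //= big1 => [|q q_neq]; last first.
  have := none q; rewrite negb_or !negb_and !negbK -!mulf_eq0.
  case/andP=> /eqP-> /eqP->; rewrite !addr0.
  have [-> |c3] := eqVneq (c i1 j1 q) 0; first by rewrite mul0r.
  by rewrite (c_target c1 c3) eqxx in q_neq.
have := none m1; rewrite negb_or !negb_and !negbK -!mulf_eq0.
case/andP=> /eqP-> /eqP->; rewrite !addr0 mulf_eq0.
by rewrite (negPf c1) (negPf c2).
Qed.

Variables (s : nat -> nat) (ex : option (nat * nat * nat)).
Hypothesis s_good : good_involution n P s ex.

(** The default i is never taken, since a good involution keeps indices below n. *)
Definition ord_involution (i : 'I_n) : 'I_n := insubd i (s i).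
Local Notation s' := ord_involution.

Lemma val_ord_involution i : s' i = s i :> nat.
Proof.
by case: s_good => s_inv _ _; rewrite val_insubd; case: (s_inv i) => // ->.
Qed.

Lemma ord_involutionK : involutive s'.
Proof.
move=> i; apply: val_inj; case: s_good => s_inv _ _ /=.
by rewrite !val_ord_involution; case: (s_inv i).
Qed.

Lemma ad_term_eq0 (a b i k : 'I_n) :
  ~~ ad_allowed s ex (val a, val i, val k) (val b, s i, s k) ->
  c a i k * c b (s' i) (s' k) = 0.
Proof.
case: s_good => _ compat _; rewrite -!val_ord_involution => not_allowed.
apply/eqP; apply: contraNT not_allowed; rewrite mulf_eq0 negb_or.
rewrite -!nonzero_arrowE => /andP[P1 P2].
have /andP[/implyP ok _] := compat _ _ P1 P2.
by apply: ok; rewrite /ad_meet /= !val_ord_involution !eqxx.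
Qed.

Lemma jac_term_eq0 (i j k l : 'I_n) :
  ~~ jac_allowed s ex (val i, val j, val k) (s i, s j, val l) ->
  c i j k * c (s' i) (s' j) l = 0.
Proof.
case: s_good => _ compat _; rewrite -!val_ord_involution => not_allowed.
apply/eqP; apply: contraNT not_allowed; rewrite mulf_eq0 negb_or.
rewrite -!nonzero_arrowE => /andP[P1 P2].
have /andP[_ /implyP ok] := compat _ _ P1 P2.
by apply: ok; rewrite /jac_meet /= !val_ord_involution !eqxx.
Qed.

Lemma unobstructed_flat : ex = None ->
  exists B : {symmetric g}, nondegenerate B /\ ricci_flat br B.
Proof.
move=> ex_none.
(* Every product of structure constants in the formula is zero, so constant weights serve. *)
apply: (sdiag_ricci_flat e_basis c_anti c_up ord_involutionK (w := fun=> 1)).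
- by [].
- by move=> _; rewrite oner_neq0.
move=> a b; rewrite /ricci_jac /ricci_ad.
rewrite !big1 ?addr0 // => i _; rewrite big1 // => j _.
- by rewrite ad_term_eq0 ?mulr0 // ex_none.
- by rewrite ad_term_eq0 ?mulr0 // ex_none.
- by rewrite jac_term_eq0 ?mulr0 // ex_none.
Qed.

(** * Balancing the one surviving Ricci component *)

Section Special.
Variables x i k : 'I_n.
Hypothesis exE : ex = Some (val x, val i, val k).

Let al := c x i k.
Let be := c x (s' i) (s' k).
Let ga := c i (s' k) (s' x).
Let de := c (s' i) k (s' x).

Lemma special_neq0 :
  [/\ s' i != i, [/\ al != 0, be != 0, ga != 0 & de != 0]
    & forall m, c i (s' i) m = 0].
Proof.
case: s_good => _ _; rewrite exE /special -!val_ord_involution !nonzero_arrowE.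
case/and5P=> i_neq al0 be0 ga0 /andP[de0 /allP none]; split=> // m.
apply/eqP; rewrite -[_ == _]negbK -nonzero_arrowE; apply: none.
by rewrite mem_iota /=.
Qed.

(** In the Jacobi identity for e_x, e_i, e_(s i), the term through [e_i, e_(s i)] is zero, and
    niceness leaves only q = k and q = s k in the other two. *)
Lemma special_jacobi : al * de = be * ga.
Proof.
have [_ [al0 be0 _ _] isi0] := special_neq0.
have := c_jacobi x i (s' i) (s' x); rewrite !big_split /=.
rewrite (bigD1 k) //= big1 ?addr0 => [|q q_neq]; last first.
  have [-> |c0] := eqVneq (c x i q) 0; first by rewrite mul0r.
  by rewrite (c_target al0 c0) eqxx in q_neq.
rewrite big1 ?addr0 => [|q _]; last by rewrite isi0 mul0r.
rewrite (bigD1 (s' k)) //= big1 ?addr0 => [|q q_neq]; last first.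
  rewrite (c_anti x).
  have [-> |c0] := eqVneq (c x (s' i) q) 0; first by rewrite oppr0 mul0r.
  by rewrite (c_target be0 c0) eqxx in q_neq.
rewrite (c_anti (s' i) k) (c_anti x) (c_anti i (s' k)) -/al -/be -/ga -/de.
by rewrite mulrN mulrNN => /eqP; rewrite addrC subr_eq0 => /eqP->.
Qed.

(* Ric(e_x, e_x) is proportional to al * be - w_x ^ 2 * ga * de, and
   al * be / (ga * de) = (al / ga) ^ 2 by [special_jacobi]. *)
Lemma special_flat :
  exists B : {symmetric g}, nondegenerate B /\ ricci_flat br B.
Proof.
have [i_neq [al0 be0 ga0 de0] _] := special_neq0.
have s'K := ord_involutionK; have s'I := inv_inj s'K.
(* The root al / ga is also put on e_(s x) to keep w invariant under [s]. The indices i and k avoid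
   both x and s x, so w_i = w_k = 1. *)
pose w y := if (y == x) || (y == s' x) then al / ga else 1.
have ws y : w (s' y) = w y.
  by rewrite /w (inv_eq s'K) (inj_eq s'I) orbC.
have c_neq u v y : c u v y != 0 -> [/\ u != v, u != y & v != y].
  move=> c0; have cvu : c v u y != 0 by rewrite c_anti oppr_eq0.
  split; first by apply: contraNneq c0 => ->; rewrite struct_const_irr.
    by rewrite neq_ltn (c_up c0).
  by rewrite neq_ltn (c_up cvu).
have [xi xk ik] := c_neq _ _ _ al0; have [isk isx _] := c_neq _ _ _ ga0.
have [sik _ ksx] := c_neq _ _ _ de0.
have wi : w i = 1 by rewrite /w eq_sym (negPf xi) (negPf isx).
have wk : w k = 1 by rewrite /w eq_sym (negPf xk) (negPf ksx).
apply: (sdiag_ricci_flat e_basis c_anti c_up s'K (w := w)) => //.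
  by move=> y; rewrite /w; case: ifP; rewrite ?oner_neq0 // mulf_neq0 ?invr_eq0.
move=> a b; have [/andP[/eqP-> /eqP->]|ab_neq] := boolP ((a == x) && (b == x)).
  have -> : ricci_ad br e s' w x x = 2 * (al * be).
    rewrite /ricci_ad pair_big /= (sum_support (L := [:: (i, k); (s' i, s' k)])).
    - rewrite !big_cons big_nil /= !s'K !ws wi wk -/al -/be.
      by field.
    - by rewrite /= inE xpair_eqE eq_sym (negPf i_neq).
    case=> i' k'; rewrite !inE !xpair_eqE => /= not_in.
    rewrite ad_term_eq0 ?mulr0 // exE /ad_allowed /= !eqxx /=.
    by rewrite -!val_ord_involution !xpair_eqE !val_eqE.
  (* The four pairs arise from exchanging the sources and from applying [s] to both; antisymmetry
     makes their contributions equal. *)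
  have -> : ricci_jac br e s' w x x = 4 * ((al / ga) ^+ 2 * (ga * de)).
    rewrite /ricci_jac pair_big /=.
    rewrite (sum_support (L := [:: (i, s' k); (s' k, i); (s' i, k); (k, s' i)])).
    - rewrite !big_cons big_nil /= !s'K !ws wi wk /w eqxx /=.
      rewrite (c_anti (s' i) k) (c_anti i (s' k)) -/ga -/de.
      by field.
    - rewrite /= !inE !xpair_eqE !(inj_eq s'I).
      rewrite [i == s' i]eq_sym [k == i]eq_sym (negPf isk) (negPf ik).
      by rewrite (negPf sik) (negPf i_neq) /= !andbF.
    case=> i' k'; rewrite !inE !xpair_eqE => /= not_in.
    rewrite jac_term_eq0 ?mulr0 // exE /jac_allowed /=.
    by rewrite !inE !xpair_eqE -!val_ord_involution !val_eqE (negPf not_in) !andbF.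
  have -> : de = be * ga / al by rewrite -special_jacobi mulrC mulKf.
  by field; rewrite al0 ga0.
(* An allowed product forces a = b = x, so the other components vanish term by term. *)
rewrite /ricci_jac /ricci_ad !big1 ?addr0 // => i' _; rewrite big1 // => k' _.
- rewrite ad_term_eq0 ?mulr0 // exE /ad_allowed /= !val_eqE.
  by rewrite andbA [(b == x) && _]andbC (negPf ab_neq).
- rewrite ad_term_eq0 ?mulr0 // exE /ad_allowed /= !val_eqE.
  by rewrite andbA (negPf ab_neq).
rewrite jac_term_eq0 ?mulr0 // exE /jac_allowed /= -!val_ord_involution !val_eqE.
by rewrite !(inj_eq s'I) andbA (negPf ab_neq).
Qed.
End Special.

Lemma good_involution_flat :
  exists B : {symmetric g}, nondegenerate B /\ ricci_flat br B.
Proof.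
case exE: ex => [[[x i] k]|]; last exact: unobstructed_flat.
have [_ _] := s_good; rewrite exE => /and5P[_ /nonzero_arrowP] /=.
move=> [x' [i' [k' [[xE iE kE] _]]]] _ _ _; rewrite xE iE kE in exE.
exact: special_flat exE.
Qed.
End GoodInvolutionFlat.

(** * Lie algebra axioms in structure constants *)

Section NiceBasis.
Variables (F : numFieldType) (g : vectType F) (br : {bilinear g -> g -> g}).
Local Notation n := (\dim {:g}).
Variable e : n.-tuple g.
Hypothesis e_basis : basis_of fullv e.
Local Notation c := (struct_const br e).

Lemma struct_const_expand (i j : 'I_n) : br e`_i e`_j = \sum_k c i j k *: e`_k.
Proof. exact: coord_basis e_basis (memvf _). Qed.

Lemma struct_const_anti : (forall x, br x x = 0) -> forall i j k, c j i k = - c i j k.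
Proof.
move=> br_alt i j k; have := br_alt (e`_i + e`_j).
rewrite !(linearDl, linearDr) !br_alt add0r addr0 => /eqP.
by rewrite addrC addr_eq0 /struct_const => /eqP->; rewrite linearN.
Qed.

Lemma struct_const_jacobi :
  (forall x y z, br x (br y z) + br y (br z x) + br z (br x y) = 0) ->
  (forall i j k, c j i k = - c i j k) -> forall i j l k,
  \sum_q (c i j q * c q l k + c j l q * c q i k + c l i q * c q j k) = 0.
Proof.
move=> br_jac c_anti i j l k.
have nest (u v z : 'I_n) : coord e k (br e`_z (br e`_u e`_v)) = - \sum_q c u v q * c q z k.
  rewrite struct_const_expand linear_sumr linear_sum -sumrN.
  apply: eq_bigr => q _; rewrite linearZr_LR linearZ /= -/(c z q k).
  by rewrite (c_anti q z) mulrN.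
have := congr1 (coord e k) (br_jac e`_l e`_i e`_j).
rewrite !linearD linear0 /= !nest -!opprD => /eqP; rewrite oppr_eq0 => /eqP.
by rewrite !big_split.
Qed.
End NiceBasis.

(** * Nice bases of nilpotent Lie algebras *)

(** p lists the indices sorted by d. The list has n elements, so the default of [nth] is never
    reached. *)
Lemma monotone_reordering n (d : 'I_n -> nat) : exists p : 'I_n -> 'I_n,
  injective p /\ (forall i j : 'I_n, (i <= j)%N -> (d (p i) <= d (p j))%N).
Proof.
pose r := relpre d leq; pose t := sort r (enum 'I_n).
have t_size : size t = n by rewrite size_sort size_enum_ord.
have t_uniq : uniq t by rewrite sort_uniq enum_uniq.
exists (fun i => nth i t i); split=> [i j|i j ij].
  rewrite (set_nth_default j i) ?t_size // => /eqP.
  by rewrite nth_uniq ?t_size // => /eqP /val_inj.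
rewrite (set_nth_default j i) ?t_size //.
have r_trans : transitive r by move=> y x z; apply: leq_trans.
have t_sorted : sorted r t by apply: sort_sorted => x y; apply: leq_total.
have r_refl : reflexive r by move=> x; apply: leqnn.
by apply: (sorted_leq_nth r_trans r_refl j t_sorted); rewrite // inE t_size.
Qed.

Section Reordering.
Variables (F : numFieldType) (g : vectType F) (br : {bilinear g -> g -> g}).
Local Notation n := (\dim {:g}).
Variables (b : n.-tuple g) (p : 'I_n -> 'I_n).
Hypotheses (b_basis : basis_of fullv b) (p_inj : injective p).

Definition reordered : n.-tuple g := [tuple b`_(p i) | i < n].

Lemma nth_reordered (i : 'I_n) : reordered`_i = b`_(p i).
Proof. by rewrite -tnth_nth tnth_mktuple. Qed.

Lemma coord_reordered_sum (k : 'I_n -> F) i :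
  coord b (p i) (\sum_j k j *: reordered`_j) = k i.
Proof.
rewrite linear_sum (bigD1 i) //= big1 => [|j j_neq]; rewrite linearZ nth_reordered /=.
  by rewrite (coord_free _ _ (basis_free b_basis)) eqxx mulr1 addr0.
rewrite (coord_free _ _ (basis_free b_basis)) (inj_eq p_inj) (negPf j_neq).
by rewrite mulr0.
Qed.

Lemma reordered_basis : basis_of fullv reordered.
Proof.
rewrite basisEfree size_tuple leqnn subvf !andbT; apply/freeP => k k0 i.
by rewrite -(coord_reordered_sum k) k0 linear0.
Qed.

Lemma struct_const_reordered i j k :
  struct_const br reordered i j k = struct_const br b (p i) (p j) (p k).
Proof.
rewrite /struct_const !nth_reordered; set v := br _ _.
by rewrite {2}(coord_basis reordered_basis (memvf v)) coord_reordered_sum.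
Qed.
End Reordering.

Section Nice.
Variables (F : numFieldType) (g : vectType F) (br : {bilinear g -> g -> g}).
Local Notation n := (\dim {:g}).
Variable b : n.-tuple g.
Hypothesis b_nice : nice_basis br b.
Local Notation c := (struct_const br b).

Lemma nice_basis_target i j k k' : c i j k != 0 -> c i j k' != 0 -> k = k'.
Proof.
have [b_basis target _] := b_nice; have [q [a brE]] := target i j.
have cE l : c i j l = a * (q == l)%:R.
  by rewrite /struct_const brE linearZ /= (coord_free _ _ (basis_free b_basis)).
rewrite !cE; have [<-|] := eqVneq q k; last by rewrite mulr0 eqxx.
by have [<-|] := eqVneq q k'; last by rewrite mulr0 eqxx.
Qed.

(** The l-th coordinate of e_i _| de^k is [- c i l k]; for a multiple of a single e^q it is zero
    unless l = q. *)
Lemma nice_basis_source i j j' k : c i j k != 0 -> c i j' k != 0 -> j = j'.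
Proof.
have [b_basis _ source] := b_nice; have [q [a dE]] := source i k.
have cE l : c i l k = - (a * (l == q)%:R).
  have := dE b`_l; rewrite (coord_free _ _ (basis_free b_basis)) => <- /=.
  by rewrite /ce_diff opprK.
rewrite !cE; have [->|] := eqVneq j q; last by rewrite mulr0 oppr0 eqxx.
by have [->|] := eqVneq j' q; last by rewrite mulr0 oppr0 eqxx.
Qed.

Hypothesis br_nil : nilpotent_lie br.

Lemma mem_lie_prod (U V : {vspace g}) x y :
  x \in U -> y \in V -> br x y \in lie_prod br U V.
Proof.
move=> /coord_vbasis-> /coord_vbasis->; rewrite linear_sumlz rpred_sum // => i _.
rewrite linear_sumr rpred_sum // => j _.
rewrite linearZl_LR linearZr_LR !rpredZ // memv_span //.
by apply: allpairs_f; apply: mem_nth; rewrite size_tuple.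
Qed.

(** The depth of a basis vector is the first term of the lower central series that omits it. A
    bracket with e_i lies one term deeper than e_i does, and by niceness so does the e_k of which it
    is a nonzero multiple. *)
Lemma nice_basis_depth : (forall x, br x x = 0) -> exists d : 'I_n -> nat,
  forall i j k, c i j k != 0 -> (d i < d k)%N.
Proof.
move=> br_alt; have [b_basis target _] := b_nice.
have [N LN] := br_nil.
have ex_out (i : 'I_n) : exists m, b`_i \notin lower_central br m.
  exists N; rewrite LN memv0; apply: (free_not0 (basis_free b_basis)).
  by rewrite mem_nth ?size_tuple.
exists (fun i => ex_minn (ex_out i)) => i j k c0.
case: ex_minnP => m _ m_min; case: ex_minnP => m' k_out _.
rewrite ltnNge; apply: contra k_out => m'_m.
(* Term 0 is the whole algebra, so the first term omitting e_k has a predecessor, which would still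
   contain e_i. *)
case: m' m'_m => [|m'] m'_m; first exact: memvf.
have i_in : b`_i \in lower_central br m'.
  by apply: contraLR m'_m => /m_min; rewrite -ltnNge.
(* [lower_central] brackets with the whole algebra on the left, so e_i has to stand on the right. *)
have brjiE : br b`_i b`_j = - br b`_j b`_i.
  have := br_alt (b`_i + b`_j).
  rewrite !(linearDl, linearDr) !br_alt add0r addr0 => /eqP.
  by rewrite addr_eq0 => /eqP->; rewrite ?opprK.
have br_in : br b`_i b`_j \in lower_central br m'.+1.
  by rewrite brjiE rpredN /= mem_lie_prod ?memvf.
have [q [a brE]] := target i j; move: c0 br_in.
rewrite /struct_const brE linearZ /= (coord_free _ _ (basis_free b_basis)).
have [<-|] := eqVneq q k; last by rewrite mulr0 eqxx.
by rewrite mulr1 rpredZeq => /negPf->.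
Qed.
End Nice.


(** * From a checked decision tree to a Ricci-flat metric *)

Lemma nice_flat_of_cover (F : numFieldType) (g : vectType F)
    (br : {bilinear g -> g -> g}) (b : (\dim {:g}).-tuple g) d :
  is_lie_bracket br -> nilpotent_lie br -> nice_basis br b ->
  covers (\dim {:g}) [::] (all_arrows (\dim {:g})) d ->
  exists B : {symmetric g}, nondegenerate B /\ ricci_flat br B.
Proof.
move=> [br_alt br_jac] br_nil b_nice d_covers.
have [b_basis _ _] := b_nice.
have [depth depth_lt] := nice_basis_depth b_nice br_nil br_alt.
have [p [p_inj p_mono]] := monotone_reordering depth.
pose e := reordered b p.
have e_basis : basis_of fullv e by apply: reordered_basis.
have cE := struct_const_reordered br b_basis p_inj.
have c_anti := struct_const_anti e br_alt.
have c_jac := struct_const_jacobi e_basis br_jac c_anti.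
have c_up i j k : struct_const br e i j k != 0 -> (i < k)%N.
  (* If k <= i, then p k is no deeper than p i, against the strict growth of depth along
     brackets. *)
  rewrite cE => /depth_lt; rewrite ltnNge; apply: contraR.
  by rewrite -leqNgt => /p_mono.
have c_target i j k k' : struct_const br e i j k != 0 ->
    struct_const br e i j k' != 0 -> k = k'.
  by rewrite !cE => c1 c2; apply/p_inj/(nice_basis_target b_nice c1 c2).
have c_source i j j' k : struct_const br e i j k != 0 ->
    struct_const br e i j' k != 0 -> j = j'.
  by rewrite !cE => c1 c2; apply/p_inj/(nice_basis_source b_nice c1 c2).
have [s [ex s_good]] : exists s ex,
    good_involution (\dim {:g}) (nonzero_arrow br e) s ex.
  apply: covers_exists d_covers.
  - exact: nonzero_arrow_lt.
  - exact: nonzero_arrow_sym.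
  - exact: nonzero_arrow_irr.
  - exact: nonzero_arrow_target.
  - exact: nonzero_arrow_source.
  - exact: nonzero_arrow_jacobi.
exact: good_involution_flat s_good.
Qed.

Theorem theorem5p6 (R : realType) (g : vectType R) (br : {bilinear g -> g -> g})
    (lie_br : is_lie_bracket br) (nil_br : nilpotent_lie br)
    (dim_g : (\dim {:g} <= 7)%N)
    (nice_g : exists b : (\dim {:g}).-tuple g, nice_basis br b) :
  exists B : {symmetric g}, nondegenerate B /\ ricci_flat br B.
Proof.
have [b b_nice] := nice_g.
have [d] : exists d, covers (\dim {:g}) [::] (all_arrows (\dim {:g})) d.
  by apply: tree_covers.
exact: nice_flat_of_cover lie_br nil_br b_nice.
Qed.
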